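(* If $\Gamma$ is an infinite finitely generated linear group over $\mathbf{C}$ (an infinite finitely generated subgroup of $\mathrm{GL}(m,\mathbf{C})$ for some $m$), then the residual average $\mathrm{Ave}(\Gamma)$ is finite.
   Context: Let $\Gamma$ be an infinite, finitely generated, residually finite group (finitely generated linear groups are residually finite). Let $\widehat{\Gamma}$ be its profinite completion, $\mu$ the Haar probability measure on $\widehat{\Gamma}$, and for a finite index subgroup $\Delta\le\Gamma$ let $\overline{\Delta}$ be the closure of (the image of) $\Delta$ in $\widehat\Gamma$. The divisibility function $D_\Gamma:\Gamma\smallsetminus\{1\}\to\mathbf{N}$ is \[ D_\Gamma(\gamma)=\min\{[\Gamma:\Delta] : \Delta\le\Gamma \text{ a finite index subgroup},\ \gamma\notin\Delta\}. \] Setting $D_\Gamma(1)=\infty$, it extends uniquely to a continuous function $D_{\widehat\Gamma}:\widehat\Gamma\to\mathbf{N}\cup\{\infty\}$, given by $D_{\widehat\Gamma}(x)=\min\{[\Gamma:\Delta] : \Delta\le\Gamma\text{ of finite index},\ x\notin\overline{\Delta}\}$ (with $\min\emptyset=\infty$). The residual average is $\mathrm{Ave}(\Gamma)=\int_{\widehat\Gamma}D_{\widehat\Gamma}\,d\mu\in[0,\infty]$. *)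

(* Defs.v *)
From HB Require Import structures.
From mathcomp Require Import all_boot all_order all_algebra complex finmap.
From mathcomp Require Import all_classical all_reals all_analysis.

Set Implicit Arguments.
Unset Strict Implicit.
Unset Printing Implicit Defensive.

Local Open Scope classical_set_scope.

(* MathComp's own 'GL_n[K] is restricted to finite K. *)
Record GL (K : fieldType) (m : nat) :=
  MkGL { GLmx :> 'M[K]_m ; GLmx_unit : GLmx \in unitmx }.

Section GL.
Variables (K : fieldType) (m : nat).
Local Open Scope ring_scope.

HB.instance Definition _ := [isSub for @GLmx K m].
HB.instance Definition _ := [Choice of GL K m by <:].

Implicit Types A B : GL K m.

Fact GL1_subproof : (1%:M : 'M[K]_m) \in unitmx. Proof. exact: unitmx1. Qed.
Fact GLM_subproof A B : A *m B \in unitmx.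
Proof. by rewrite unitmx_mul !GLmx_unit. Qed.
Fact GLV_subproof A : invmx A \in unitmx.
Proof. by rewrite unitmx_inv GLmx_unit. Qed.

Definition GL1 := MkGL GL1_subproof.
Definition GLM A B := MkGL (GLM_subproof A B).
Definition GLV A := MkGL (GLV_subproof A).

Fact GLMA : associative GLM.
Proof. by move=> A B C; apply: val_inj; rewrite /= mulmxA. Qed.
Fact GL1M : left_id GL1 GLM.
Proof. by move=> A; apply: val_inj; rewrite /= mul1mx. Qed.
Fact GLM1 : right_id GL1 GLM.
Proof. by move=> A; apply: val_inj; rewrite /= mulmx1. Qed.
Fact GLVM : left_inverse GL1 GLV GLM.
Proof. by move=> A; apply: val_inj; rewrite /= mulVmx// GLmx_unit. Qed.
Fact GLMV : right_inverse GL1 GLV GLM.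
Proof. by move=> A; apply: val_inj; rewrite /= mulmxV// GLmx_unit. Qed.

HB.instance Definition _ := isGroup.Build (GL K m) GLMA GL1M GLM1 GLVM GLMV.

End GL.

Section Subgroups.
Variable G : groupType.
Implicit Types D N S : set G.

Definition is_subgroup D :=
  [/\ D 1%g, (forall x y, D x -> D y -> D (x * y)%g)
    & (forall x, D x -> D x^-1%g)].

Definition is_normal N := forall x g, N x -> N (x ^ g)%g.

Definition lcoset D (g : G) : set G := [set (g * x)%g | x in D].

Definition lcosets D : set (set G) := range (lcoset D).

Definition finite_index D := finite_set (lcosets D).

(* Meaningful only when [finite_index D]; otherwise [fset_set] is empty. *)
Definition subgroup_index D : nat := #|` fset_set (lcosets D) |%fset.

Definition finitely_generated :=
  exists2 S, finite_set S & smallest is_subgroup S = [set: G].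

Record fin_normal := FinNormal {
  fin_normal_set :> set G ;
  fin_normal_subgroup : is_subgroup fin_normal_set ;
  fin_normal_normal : is_normal fin_normal_set ;
  fin_normal_index : finite_index fin_normal_set }.

HB.instance Definition _ := gen_eqMixin fin_normal.
HB.instance Definition _ := gen_choiceMixin fin_normal.

End Subgroups.

(* The inverse limit of the finite quotients G / N; a point is a family of
   cosets of the N compatible with the projections G / N -> G / M, N <= M. *)
Record profinite (G : groupType) := Profinite {
  component :> fin_normal G -> set G ;
  componentP : forall N : fin_normal G, lcosets N (component N) ;
  component_compat : forall N M : fin_normal G,
    N `<=` M -> component N `<=` component M }.

Section ProfiniteCompletion.
Variable G : groupType.
Implicit Types (x y z : profinite G) (N M : fin_normal G).

HB.instance Definition _ := gen_eqMixin (profinite G).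
HB.instance Definition _ := gen_choiceMixin (profinite G).

(* Subspace topology of the product of discrete spaces. *)
HB.instance Definition _ := Topological.copy (profinite G)
  (initial_topology (@component G
     : profinite G -> {ptws fin_normal G -> discrete_topology (set G)})).

Lemma profinite_eq x y : (forall N, x N = y N) -> x = y.
Proof.
case: x y => [x xP xC] [y yP yC] /= xy.
have {}xy : x = y by apply/funext.
by case: _ / xy yP yC => yP yC; congr Profinite; exact: Prop_irrelevance.
Qed.

Lemma lcoset_mul N a b :
  [set (u * v)%g | u in lcoset N a & v in lcoset N b] = lcoset N (a * b)%g.
Proof.
have [N1 NM NV] := fin_normal_subgroup N.
apply/seteqP; split=> [_ [_ [u Nu <-]] [_ [v Nv <-]] <-|_ [u Nu <-]].
  exists (u ^ b * v)%g; first by apply: NM => //; exact: fin_normal_normal.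
  by rewrite /conjg !mulgA mulgK.
exists a; first by exists 1%g => //; rewrite mulg1.
by exists (b * u)%g; [exists u | rewrite mulgA].
Qed.

Lemma lcoset_inv N a : [set u^-1%g | u in lcoset N a] = lcoset N a^-1%g.
Proof.
have [N1 NM NV] := fin_normal_subgroup N.
apply/seteqP; split=> [_ [_ [u Nu <-]] <-|_ [u Nu <-]].
  exists ((u^-1) ^ a^-1)%g; first by apply: fin_normal_normal; exact: NV.
  by rewrite /conjg invgK invgM !mulgA mulVg mul1g.
exists (u^-1 * a)%g; last by rewrite invgM invgK.
exists ((u^-1) ^ a)%g; first by apply: fin_normal_normal; exact: NV.
by rewrite /conjg !mulgA mulgV mul1g.
Qed.

Lemma lcoset1 N : lcoset N 1%g = N.
Proof.
apply/seteqP; split=> [_ [u Nu <-]|u Nu]; first by rewrite mul1g.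
by exists u => //; rewrite mul1g.
Qed.

Fact to_profinite_compat (g : G) N M :
  N `<=` M -> lcoset N g `<=` lcoset M g.
Proof. by move=> NM _ [u Nu <-]; exists u => //; exact: NM. Qed.

Definition to_profinite (g : G) : profinite G :=
  @Profinite G (fun N => lcoset N g) (fun N => ex_intro2 _ _ g I erefl)
    (@to_profinite_compat g).

Definition pmul_component x y N : set G := [set (u * v)%g | u in x N & v in y N].

Fact pmulP x y N : lcosets N (pmul_component x y N).
Proof.
rewrite /pmul_component; have [a _ <-] := componentP x N.
have [b _ <-] := componentP y N.
by exists (a * b)%g => //; rewrite lcoset_mul.
Qed.

Fact pmul_compat x y N M :
  N `<=` M -> pmul_component x y N `<=` pmul_component x y M.
Proof.
move=> NM _ [u xu [v yv <-]]; exists u; first exact: component_compat xu.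
by exists v => //; exact: component_compat yv.
Qed.

Definition pmul x y := Profinite (pmulP x y) (@pmul_compat x y).

Definition pinv_component x N : set G := [set u^-1%g | u in x N].

Fact pinvP x N : lcosets N (pinv_component x N).
Proof.
rewrite /pinv_component; have [a _ <-] := componentP x N.
by exists a^-1%g => //; rewrite lcoset_inv.
Qed.

Fact pinv_compat x N M :
  N `<=` M -> pinv_component x N `<=` pinv_component x M.
Proof.
by move=> NM _ [u xu <-]; exists u => //; exact: component_compat xu.
Qed.

Definition pinv x := Profinite (pinvP x) (@pinv_compat x).

Definition pone : profinite G := to_profinite 1%g.

Let pE :=
  (lcoset_mul, lcoset_inv, @mulgA G, @mul1g G, @mulg1 G, @mulVg G, @mulgV G).

Fact pmulA : associative pmul.
Proof.
move=> x y z; apply: profinite_eq => N /=; rewrite /pmul_component /=.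
rewrite /pmul_component; have [a _ <-] := componentP x N.
by have [b _ <-] := componentP y N; have [c _ <-] := componentP z N; rewrite !pE.
Qed.

Fact pmul1g : left_id pone pmul.
Proof.
move=> x; apply: profinite_eq => N /=; rewrite /pmul_component /=.
by have [a _ <-] := componentP x N; rewrite !pE.
Qed.

Fact pmulg1 : right_id pone pmul.
Proof.
move=> x; apply: profinite_eq => N /=; rewrite /pmul_component /=.
by have [a _ <-] := componentP x N; rewrite !pE.
Qed.

Fact pmulVg : left_inverse pone pinv pmul.
Proof.
move=> x; apply: profinite_eq => N /=.
rewrite /pmul_component /= /pinv_component.
by have [a _ <-] := componentP x N; rewrite !pE.
Qed.

Fact pmulgV : right_inverse pone pinv pmul.
Proof.
move=> x; apply: profinite_eq => N /=.
rewrite /pmul_component /= /pinv_component.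
by have [a _ <-] := componentP x N; rewrite !pE.
Qed.

HB.instance Definition _ :=
  isGroup.Build (profinite G) pmulA pmul1g pmulg1 pmulVg pmulgV.
HB.instance Definition _ := isPointed.Build (profinite G) 1%g.

Lemma to_profiniteM : {morph to_profinite : g h / (g * h)%g}.
Proof.
by move=> g h; apply: profinite_eq => N; rewrite /= /pmul_component /= lcoset_mul.
Qed.

End ProfiniteCompletion.

Definition borel (G : groupType) := g_sigma_algebraType (@open (profinite G)).

Section ResidualAverage.
Variables (R : realType) (G : groupType).
Local Open Scope ereal_scope.

(* A left-invariant regular Borel probability measure; it is unique. *)
Definition is_haar (mu : probability (borel G) R) :=
  [/\ forall (g : profinite G) (A : set (profinite G)),
        measurable (A : set (borel G)) ->
        mu [set (g * x)%g | x in A] = mu A,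
      forall A : set (profinite G), measurable (A : set (borel G)) ->
        mu A = ereal_inf [set mu U | U in [set U | open U /\ A `<=` U]]
    & forall U : set (profinite G), open U ->
        mu U = ereal_sup [set mu K | K in [set K | compact K /\ K `<=` U]]].

(* The infimum is that of a set of natural numbers, hence a minimum when the
   set is nonempty, and is +oo when it is empty. *)
Definition divisibility (x : profinite G) : \bar R :=
  ereal_inf [set (subgroup_index D)%:R%:E | D in
    [set D : set G | [/\ is_subgroup D, finite_index D
                       & ~ closure (@to_profinite G @` D) x]]].

Definition residual_average (mu : probability (borel G) R) : \bar R :=
  \int[mu]_x divisibility x.

End ResidualAverage.

(* Main.v *)
(* Two distinct primes suffice. Call l good if, for some constant C and every i,
   Gamma has a finite index subgroup whose index is a multiple of l^i and at
   most C l^i. If p and q are good, choose such subgroups H_n for p^n and K_n for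
   q^j, where q^j <= p^n < q^(j+1). By coprimality H_n and K_n meet in a
   subgroup of index at least p^n q^j, so the set V_n of profinite points lying
   in both closures has measure O(p^(-2n)), whereas D <= C p^n off V_n; hence
   the integral of D is at most a constant times the sum of p^n p^(-2n).

   All large primes l are good. The matrices of Gamma have entries in a finitely
   generated domain A of characteristic 0. By induction on generators, for every
   nonzero h in A there is a morphism from A to a finite commutative ring R in
   which l is nilpotent, not killing h, where R modulo its nilradical has size
   bounded independently of h. Taking h to separate many elements of Gamma, the
   image of Gamma in GL_m(R) is arbitrarily large, and its intersection with the
   congruence subgroup of the nilradical, an l-group, has bounded index. *)

From HB Require Import structures.
Require Import Defs.
From mathcomp Require Import all_boot all_order all_fingroup all_algebra.
From mathcomp Require Import all_solvable complex finmap.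
From mathcomp Require Import all_classical all_reals all_analysis.
From mathcomp Require Import measurable_realfun ring zify.

Set Implicit Arguments.
Unset Strict Implicit.
Unset Printing Implicit Defensive.

Import Order.TTheory GRing.Theory Num.Theory.

Local Open Scope ring_scope.

(** * Nilpotent elements and finite quotients *)

Definition is_nilpotent (R : pzRingType) (a : R) := exists n, a ^+ n = 0.

Section Nilpotent.
Variable R : comNzRingType.
Implicit Types a b : R.

Lemma is_nilpotent0 : is_nilpotent (0 : R).
Proof. by exists 1%N; rewrite expr1. Qed.

Lemma is_nilpotentMl a b : is_nilpotent b -> is_nilpotent (a * b).
Proof. by case=> n bn0; exists n; rewrite exprMn bn0 mulr0. Qed.

Lemma is_nilpotentD a b : is_nilpotent a -> is_nilpotent b -> is_nilpotent (a + b).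
Proof.
move=> [n an0] [m bm0]; exists (n + m)%N; rewrite exprDn big1// => i _.
have [ni|ni] := leqP n (n + m - i).
  by rewrite -(subnK ni) exprD an0 mulr0 mul0r mul0rn.
have mi : (m <= i)%N by lia.
by rewrite -(subnK mi) exprD bm0 !mulr0 mul0rn.
Qed.

Lemma is_nilpotent_sum I (r : seq I) (P : pred I) (F : I -> R) :
  (forall i, P i -> is_nilpotent (F i)) -> is_nilpotent (\sum_(i <- r | P i) F i).
Proof.
by move=> FP; elim/big_ind: _ => //; [exact: is_nilpotent0|exact: is_nilpotentD].
Qed.

(** The inverse is the finite geometric series in [- a]. *)
Lemma is_nilpotent_unit a : is_nilpotent a -> exists u, (1 + a) * u = 1.
Proof.
move=> [n an0]; exists (\sum_(i < n) (- a) ^+ i).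
have := subrXX 1 (- a) n; rewrite expr1n exprNn an0 mulr0 subr0 opprK => E.
by rewrite [RHS]E; congr (_ * _); apply: eq_bigr => i _; rewrite expr1n mul1r.
Qed.

End Nilpotent.

Lemma is_nilpotent_rmorph (R S : comNzRingType) (f : {rmorphism R -> S}) a :
  is_nilpotent a -> is_nilpotent (f a).
Proof. by move=> [n an0]; exists n; rewrite -rmorphXn an0 rmorph0. Qed.

Lemma is_nilpotent_poly (R : comNzRingType) (p : {poly R}) :
  (forall i, is_nilpotent p`_i) -> is_nilpotent p.
Proof.
move=> pP; rewrite -(coefK p) poly_def; apply: is_nilpotent_sum => i _.
rewrite -mul_polyC mulrC; apply: is_nilpotentMl.
exact: (is_nilpotent_rmorph (polyC : {rmorphism R -> {poly R}})).
Qed.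

(* The quotient of [R] by its nilradical has at most [C] elements. *)
Definition nil_classes (R : comNzRingType) (C : nat) :=
  exists (T : finType) (k : R -> T),
    (#|T| <= C)%N /\ forall a b, k a = k b -> is_nilpotent (a - b).

HB.instance Definition _ (R : finComNzRingType) (g : {poly R}) :=
  GRing.ComNzRing.on {poly %/ g}.
HB.instance Definition _ (R : finComNzRingType) (g : {poly R}) :=
  Finite.on {poly %/ g}.

Import Pdiv.CommonRing Pdiv.RingMonic.

(** [g] is nilpotent modulo [g ^+ N], so up to a nilpotent an element is its remainder modulo [g],
    which is given by the classes of its [(size g).-1] coefficients. The bound is therefore
    independent of [N]. *)
Lemma nil_classes_qpoly (R : finComNzRingType) (g : {poly R}) N C :
  g \is monic -> (1 < size g)%N -> (0 < N)%N -> nil_classes R C ->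
  nil_classes {poly %/ g ^+ N} (C ^ (size g).-1).
Proof.
move=> gm g1 N0 [T [k [TC kP]]].
have gNm : g ^+ N \is monic by rewrite monic_exp.
have gN1 : (1 < size (g ^+ N))%N.
  case: N N0 {gNm} => // N _; rewrite exprS size_monicM ?monic_neq0 ?monic_exp//.
  have : (0 < size (g ^+ N))%N.
    by rewrite size_poly_gt0 monic_neq0 ?monic_exp.
  by lia.
have mkE : mk_monic (g ^+ N) = g ^+ N by rewrite /mk_monic gN1 gNm.
exists {ffun 'I_(size g).-1 -> T},
  (fun p : {poly %/ g ^+ N} => [ffun i : 'I_ _ => k (rmodp (p : {poly R}) g)`_i]).
split; first by rewrite card_ffun card_ord leq_exp2r // -subn1 subn_gt0.
move=> a b /ffunP ab.
have gq0 : is_nilpotent (in_qpoly (g ^+ N) g).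
  exists N; rewrite -rmorphXn; apply: val_inj => /=.
  by rewrite mkE rmodpp.
have {ab} : is_nilpotent (rmodp (a : {poly R}) g - rmodp (b : {poly R}) g).
  apply: is_nilpotent_poly => i; rewrite coefB.
  have [ig|ig] := ltnP i (size g).-1.
    by apply: kP; have := ab (Ordinal ig); rewrite !ffunE.
  have mg (p : {poly R}) : (rmodp p g)`_i = 0.
    rewrite nth_default // (leq_trans _ ig) // -ltnS (ltn_predK g1).
    by rewrite ltn_rmodpN0 // monic_neq0.
  by rewrite !mg subr0; exact: is_nilpotent0.
move=> /(is_nilpotent_rmorph (in_qpoly (g ^+ N))) ab.
have inK (p : {poly %/ g ^+ N}) : in_qpoly (g ^+ N) p = p.
  by apply: val_inj; rewrite /= rmodp_small // size_mk_monic.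
rewrite -(inK a) -(inK b) (rdivp_eq gm (a : {poly R})).
rewrite (rdivp_eq gm (b : {poly R})) -rmorphB /= opprD addrACA -mulrBl.
rewrite rmorphD rmorphM; apply: is_nilpotentD; last exact: ab.
exact: is_nilpotentMl.
Qed.

Definition specialization (A : comNzRingType) (l C : nat) (s h : A) :=
  exists (R : finComNzRingType) (phi : {rmorphism A -> R}),
    [/\ exists u, phi s * u = 1, phi h != 0,
        exists k, (l ^ k)%:R = 0 :> R & nil_classes R C].

(** The bound [C] is chosen before [h], while the finite ring and its exponent [k] may depend on
    [h]. Making [s] invertible carries the induction on generators: it gives control over leading
    coefficients. *)
Definition specializable (A : comNzRingType) :=
  forall s : A, s != 0 -> exists L, forall l, prime l -> (L < l)%N ->
    exists C, forall h : A, h != 0 -> specialization l C s h.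
(** * Specialization of finitely generated domains *)

(** Choose preimages under [ev]; the kernel condition makes the value of [psi] independent of the
    choice. *)
Lemma factor_rmorphism (P B R : nzRingType) (ev : {rmorphism P -> B})
    (psi : {rmorphism P -> R}) :
  (forall b, exists p, ev p = b) -> (forall p, ev p = 0 -> psi p = 0) ->
  exists phi : {rmorphism B -> R}, forall p, phi (ev p) = psi p.
Proof.
move=> surj ker.
have wd p q : ev p = ev q -> psi p = psi q.
  move=> pq; apply/eqP; rewrite -subr_eq0 -rmorphB; apply/eqP/ker.
  by rewrite rmorphB pq subrr.
pose phi b := psi (sval (cid (surj b))).
have phiE p : phi (ev p) = psi p by apply: wd; exact: svalP (cid (surj (ev p))).
have phiB : zmod_morphism phi.
  move=> a b; have [p <-] := surj a; have [q <-] := surj b.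
  by rewrite -rmorphB !phiE rmorphB.
have phiM : monoid_morphism phi.
  split; first by rewrite -(rmorph1 ev) phiE rmorph1.
  move=> a b; have [p <-] := surj a; have [q <-] := surj b.
  by rewrite -rmorphM !phiE rmorphM.
pose phiB' := GRing.isZmodMorphism.Build B R phi phiB.
pose phiM' := GRing.isMonoidMorphism.Build B R phi phiM.
pose phi' : {rmorphism B -> R} := HB.pack phi phiB' phiM'.
by exists phi'.
Qed.

Lemma monic_coef (R : nzRingType) (p : {poly R}) n :
  (size p <= n.+1)%N -> p`_n = 1 -> p \is monic /\ size p = n.+1.
Proof.
move=> pn pn1; have sp : size p = n.+1.
  apply/eqP; rewrite eqn_leq pn ltnNge; apply/negP => /(nth_default 0).
  by rewrite pn1; apply/eqP; rewrite oner_eq0.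
by split=> //; rewrite monicE /lead_coef sp pn1.
Qed.

Section Extension.
Variables (A B : comNzRingType) (ev : {rmorphism {poly A} -> B}).
Hypothesis Bdomain : forall a b : B, a * b = 0 -> a = 0 \/ b = 0.
Hypothesis ev_surj : forall b, exists p, ev p = b.
Hypothesis evC_inj : forall a, ev a%:P = 0 -> a = 0.
Hypothesis A_spec : specializable A.

(** The common end of the transcendental and the algebraic case: reduction modulo [g ^+ N] kills the
    kernel of [ev], hence descends from [{poly A}] to [B]. *)
Lemma qpoly_specialization (R : finComNzRingType) (phi : {rmorphism A -> R})
    (g : {poly R}) N l C s h :
  g \is monic -> (1 < size g)%N -> (0 < N)%N ->
  (exists k, (l ^ k)%:R = 0 :> R) -> nil_classes R C ->
  (forall p, ev p = 0 -> in_qpoly (g ^+ N) (map_poly phi p) = 0) ->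
  (exists u, in_qpoly (g ^+ N) (map_poly phi s) * u = 1) ->
  in_qpoly (g ^+ N) (map_poly phi h) != 0 ->
  specialization l (C ^ (size g).-1) (ev s) (ev h).
Proof.
move=> gm g1 N0 [k lk] RC ker su hn0.
have [phi' phi'E] :=
  factor_rmorphism (psi := in_qpoly (g ^+ N) \o map_poly phi) ev_surj ker.
exists {poly %/ g ^+ N}, phi'; split.
- by rewrite phi'E.
- by rewrite phi'E.
- exists k; have := rmorph_nat (in_qpoly (g ^+ N)) (l ^ k) => <-.
  by rewrite -polyC_natr lk rmorph0.
- exact: nil_classes_qpoly.
Qed.

(* With [g = 1 + u X s], the power [g ^+ N] makes [s] invertible in
   [R[X]/(g ^+ N)], because [g] is nilpotent there; a large [N] keeps [h] alive
   and does not affect the bound of [nil_classes_qpoly]. *)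
Lemma specializable_transcendental :
  (forall p, ev p = 0 -> p = 0) -> specializable B.
Proof.
move=> ev_inj _s; have [s <-] := ev_surj _s => sn0.
have {}sn0 : s != 0 by apply: contra_neq sn0 => ->; rewrite rmorph0.
have [L LP] := A_spec (s := lead_coef s) ltac:(by rewrite lead_coef_eq0).
exists L => l lp /(LP l lp)[C CP]; exists (C ^ size s)%N => _h.
have [h <-] := ev_surj _h => hn0.
have {}hn0 : h != 0 by apply: contra_neq hn0 => ->; rewrite rmorph0.
have [R [phi [[u su] phih lk RC]]] := CP (lead_coef h) ltac:(by rewrite lead_coef_eq0).
pose s' := map_poly phi s; pose n := size s.
(* [u] inverts the image of the leading coefficient of [s], so [g] is monic of degree [size s]. *)
pose g := u *: ('X * s') + 1.
have n0 : (0 < n)%N by rewrite size_poly_gt0.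
have [gm sg] : g \is monic /\ size g = n.+1.
  apply: monic_coef.
    rewrite (leq_trans (size_polyD _ _))// geq_max size_poly1 ltnS leq0n andbT.
    rewrite (leq_trans (size_scale_leq _ _))// mulrC.
    rewrite (leq_trans (size_polyMleq _ _))// size_polyX addn2 ltnS /=.
    exact: size_poly.
  rewrite coefD coefZ coefXM coef1 (gtn_eqF n0) addr0.
  by rewrite coef_map mulrC.
have sz_gN N : size (g ^+ N) = (n * N).+1.
  elim: N => [|N IH]; first by rewrite expr0 size_poly1 muln0.
  rewrite exprS size_monicM ?monic_neq0 ?monic_exp//; rewrite sg IH mulnS; lia.
have mkE : mk_monic (g ^+ (size h).+1) = g ^+ (size h).+1.
  by rewrite /mk_monic sz_gN monic_exp// ltnS muln_gt0 n0.
rewrite -[size s]/(n.+1.-1) -sg.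
apply: (@qpoly_specialization R phi g (size h).+1 l C s h gm _ _ lk RC) => //.
- by rewrite sg.
- by move=> p /ev_inj ->; rewrite !rmorph0.
- pose q : {rmorphism {poly R} -> {poly %/ g ^+ (size h).+1}} := in_qpoly _.
  have gnil : is_nilpotent (- q g).
    exists (size h).+1; rewrite exprNn -rmorphXn [X in _ * X](_ : _ = 0) ?mulr0//.
    by apply: val_inj; rewrite /= mkE rmodpp// monic_exp.
  have [v vP] := is_nilpotent_unit gnil; exists (- (q (u *: 'X) * v)).
  change (q s' * - (q (u *: 'X) * v) = 1).
  rewrite -[RHS]vP mulrN mulrA -mulNr -rmorphM -rmorphN.
  rewrite -[1 in RHS](rmorph1 q) -rmorphB; congr (q _ * _).
  by rewrite /g opprD addrCA subrr addr0 -scalerAr (mulrC s').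
(* The degree of [g ^+ (size h).+1] exceeds that of [h], so the image of [h] is its own remainder
   and keeps the nonzero coefficient [phi (lead_coef h)]. *)
apply: contra phih => /eqP/(congr1 val)/=; rewrite mkE rmodp_small; last first.
  rewrite sz_gN ltnS (leq_trans (size_poly _ _))//.
  by rewrite (leq_trans (leqnSn _))// leq_pmull.
by move=> /(congr1 (fun p : {poly R} => p`_(size h).-1)); rewrite coef_map coef0 => ->.
Qed.

Let Adomain (a b : A) : a * b = 0 -> a = 0 \/ b = 0.
Proof.
move=> ab; have : ev a%:P * ev b%:P = 0 by rewrite -rmorphM -polyCM ab !rmorph0.
by case/Bdomain => /evC_inj; [left|right].
Qed.

Let Apow_neq0 (a : A) n : a != 0 -> a ^+ n != 0.
Proof.
move=> a0; elim: n => [|n IH]; first by rewrite expr0 oner_eq0.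
by rewrite exprS; apply/eqP => /Adomain[]/eqP; apply/negP.
Qed.

Section Algebraic.
Variable f : {poly A}.
Hypothesis f_neq0 : f != 0.
Hypothesis f_root : ev f = 0.
Hypothesis f_min : forall p, ev p = 0 -> p != 0 -> (size f <= size p)%N.

Let evC_neq0 (a : A) : a != 0 -> ev a%:P != 0.
Proof. by move=> a0; apply: contra_neq a0; exact: evC_inj. Qed.

Lemma pseudo_div (p q : {poly A}) : q != 0 -> exists k d r,
  (lead_coef q ^+ k)%:P * p = d * q + r /\ (size r < size q)%N.
Proof.
move=> q0; exists (rscalp p q), (rdivp p q), (rmodp p q).
by rewrite mul_polyC Pdiv.ComRing.rdivp_eq ltn_rmodpN0.
Qed.

(** The pseudo-remainder of [p] by [f] lies in the kernel and is shorter than [f], so it vanishes by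
    minimality. *)
Lemma ev_ker p : ev p = 0 -> exists k q, (lead_coef f ^+ k)%:P * p = q * f.
Proof.
move=> p0; have [k [q [r [E rf]]]] := pseudo_div p f_neq0.
exists k, q; rewrite E; suff -> : r = 0 by rewrite addr0.
apply/eqP; apply: contraTT rf => r0; rewrite -leqNgt f_min//.
have := congr1 ev E.
by rewrite rmorphD !rmorphM/= p0 f_root !mulr0 add0r => /esym.
Qed.

(** A substitute for the norm, found by Euclidean descent on the size of [p]: pass to the
    pseudo-remainder of [p] by [f] or of [f] by [p], whichever polynomial is shorter being the
    divisor. *)
Lemma ev_norm p : ev p != 0 -> exists q a, a != 0 /\ ev p * ev q = ev a%:P.
Proof.
have [n] := ubnP (size p); elim: n p => // n IH p pn p0.
have p_neq0 : p != 0 by apply: contra_neq p0 => ->; rewrite rmorph0.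
have lp0 : lead_coef p != 0 by rewrite lead_coef_eq0.
have lf0 : lead_coef f != 0 by rewrite lead_coef_eq0.
have mul_eq0 (a b : B) : a * b = 0 -> a != 0 -> b = 0.
  by move=> /Bdomain[->|//]; rewrite eqxx.
have [fp|pf] := leqP (size f) (size p).
  have [k [d [r [E rf]]]] := pseudo_div p f_neq0.
  have := congr1 ev E.
  rewrite rmorphD !rmorphM/= f_root mulr0 add0r => {}E.
  have r0 : ev r != 0.
    apply/eqP => r0; move: E; rewrite r0 => /mul_eq0 p0'.
    by move/eqP: p0; apply; apply: p0'; rewrite evC_neq0 ?Apow_neq0.
  have [q [a [a0 qa]]] := IH r (leq_ltn_trans (leq_trans rf fp) pn) r0.
  exists ((lead_coef f ^+ k)%:P * q), a; split => //.
  by rewrite rmorphM mulrA [ev p * _]mulrC E.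
have [k [d [r [E rp]]]] := pseudo_div f p_neq0.
have := congr1 ev E.
rewrite rmorphD !rmorphM/= f_root mulr0 => /esym Er.
have [r0|r0] := eqVneq (ev r) 0; last first.
  have [q [a [a0 qa]]] := IH r (leq_trans rp pn) r0.
  exists (- (d * q)), a; split=> //; rewrite -qa rmorphN rmorphM.
  have -> : ev r = - (ev d * ev p) by apply/eqP; rewrite -addr_eq0 addrC Er.
  by rewrite mulrN mulNr mulrA (mulrC (ev p)).
(* The descent stops here: [d * p] is a constant multiple of [f] with [d] in the kernel, so [d] is
   at least as long as [f] and [p] is constant. *)
have {r0 rp}r0 : r = 0.
  by apply/eqP; apply: contraTT (ltn_trans rp pf) => rn0; rewrite -leqNgt f_min.
move: E Er; rewrite r0 addr0 rmorph0 addr0 mulrC => E.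
rewrite mulrC => /mul_eq0 /(_ p0) d0.
have cf0 : lead_coef p ^+ k * lead_coef f != 0.
  by apply/eqP => /Adomain[]/eqP; apply/negP => //; exact: Apow_neq0.
have d_neq0 : d != 0.
  apply: contra_neq cf0 => d0'; have := congr1 (coefp (size f).-1) E.
  by rewrite d0' mul0r mulrC mul_polyC /= coefZ coef0.
have lead_dp : lead_coef d * lead_coef p != 0.
  by apply/eqP => /Adomain[]/eqP; apply/negP => //; rewrite lead_coef_eq0.
have := size_scale_leq (lead_coef p ^+ k) f.
rewrite -mul_polyC mulrC E size_proper_mul// => szp.
have := f_min d0 d_neq0 => szd.
have /size1_polyC pC : (size p <= 1)%N.
  have := d_neq0; rewrite -size_poly_gt0 => d_gt0; lia.
exists 1, p`_0; rewrite rmorph1 mulr1 -pC; split => //.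
by apply: contra_neq p0 => p00; rewrite pC p00 rmorph0.
Qed.

(* [f] becomes monic up to a unit once its leading coefficient is inverted, and
   [s], [h] are replaced by nonzero multiples lying in [A]. *)
Lemma specializable_algebraic : specializable B.
Proof.
move=> _s; have [s <-] := ev_surj _s => sn0.
have [s' [a [a0 sa]]] := ev_norm sn0.
have c0 : lead_coef f != 0 by rewrite lead_coef_eq0.
have ca0 : lead_coef f * a != 0 by apply/eqP => /Adomain[]/eqP; apply/negP.
have [L LP] := A_spec ca0.
exists L => l lp /(LP l lp)[C CP]; exists (C ^ (size f).-1)%N => _h.
have [h <-] := ev_surj _h => hn0.
have [h' [b [b0 hb]]] := ev_norm hn0.
have [R [phi [[u su] phib lk RC]]] := CP b b0.
move: su; rewrite rmorphM; set c := phi (lead_coef f) => su.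
(* As [c * phi a * u = 1], the inverse of [c] is [phi a * u] and that of [phi a] is [c * u]. *)
pose f' := map_poly phi f; pose g := (phi a * u) *: f'.
have f_gt1 : (1 < size f)%N.
  rewrite ltnNge; apply/negP => /size1_polyC fC.
  by move: f_root f_neq0; rewrite fC => /evC_inj ->; rewrite eqxx.
have [gm sg] : g \is monic /\ size g = (size f).-1.+1.
  apply: monic_coef.
    by rewrite (leq_trans (size_scale_leq _ _))// (ltn_predK f_gt1) size_poly.
  by rewrite coefZ coef_map /= -lead_coefE -/c -su; ring.
rewrite -[(size f).-1]/((size f).-1.+1.-1) -sg.
have mkE : mk_monic (g ^+ 1) = g by rewrite expr1 /mk_monic sg gm; case: ifP => //; lia.
pose q : {rmorphism {poly R} -> {poly %/ g ^+ 1}} := in_qpoly _.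
have qg : q g = 0 by apply: val_inj; rewrite /= mkE rmodpp.
have f'E : f' = c *: g.
  rewrite scalerA [X in X *: _](_ : _ = 1) ?scale1r//.
  by rewrite -su; ring.
have cu n (p : {poly R}) : (c ^+ n)%:P * ((phi a * u) ^+ n)%:P * p = p.
  rewrite -polyCM -exprMn [X in X ^+ n](_ : _ = 1) ?expr1n ?mul1r//.
  by rewrite -su; ring.
(* A power of [c] times the image of [p] is a multiple of [g], and [c] is a unit. *)
have qker p : ev p = 0 -> q (map_poly phi p) = 0.
  move=> /ev_ker[k [d /(congr1 (map_poly phi))]].
  rewrite !rmorphM/= map_polyC/= rmorphXn/= -/c -/f' f'E => E.
  rewrite -(cu k (map_poly phi p)) mulrAC E -mul_polyC.
  by rewrite !rmorphM/= qg !(mulr0, mul0r).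
have qmul x y z : ev x * ev y = ev z%:P ->
    q (map_poly phi x) * q (map_poly phi y) = q (phi z)%:P.
  move=> xyz; rewrite -rmorphM -rmorphM -map_polyC.
  by apply/eqP; rewrite -subr_eq0 -!rmorphB qker// rmorphB rmorphM xyz subrr.
apply: (@qpoly_specialization R phi g 1 l C s h gm _ _ lk RC qker) => //.
- by rewrite sg; lia.
- exists (q (map_poly phi s') * q (c * u)%:P).
  change (q (map_poly phi s) * (q (map_poly phi s') * q (c * u)%:P) = 1).
  rewrite mulrA (qmul _ _ _ sa) -rmorphM -polyCM [X in X%:P](_ : _ = 1) ?rmorph1//.
  by rewrite -su; ring.
apply: contra phib => /eqP h0.
have := qmul _ _ _ hb; rewrite {1}[q _]h0 mul0r => /(congr1 val)/=.
rewrite mkE rmodp_small; last first.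
  by rewrite sg (leq_ltn_trans (size_polyC_leq1 _))//; lia.
by move=> /esym/(congr1 (fun p : {poly R} => p`_0)); rewrite coef0 coefC /= => ->.
Qed.

End Algebraic.

(** Either the kernel of [ev] is zero and [B] is a polynomial ring over [A], or it has a nonzero
    element of least size, which acts as a minimal polynomial. *)
Theorem specializable_extension : specializable B.
Proof.
have [ev_inj|/existsNP[p /not_implyP[p0 /eqP pn0]]] :=
  pselect (forall p, ev p = 0 -> p = 0).
  exact: specializable_transcendental.
pose P n := `[< exists p, [/\ ev p = 0, p != 0 & size p = n] >].
have exP : exists n, P n by exists (size p); apply/asboolP; exists p.
case: (ex_minnP exP) => n /asboolP[f [f0 fn0 <-]] fmin.
apply: (specializable_algebraic fn0 f0) => q q0 qn0.
by apply: fmin; apply/asboolP; exists q.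
Qed.

End Extension.

(** * The integers and finitely generated subrings of a field *)

(** Reduce modulo a power of [l] exceeding the absolute value of [h]; a prime above that of [s] does
    not divide [s]. Residues modulo [l] determine classes up to nilpotents, so [C] is [l]. *)
Lemma specializable_int : specializable int.
Proof.
move=> s s0; exists `|s|%N => l lp sl; exists l => h h0.
pose k := `|h|.+1; pose n := (l ^ k)%N.
have l1 : (1 < l)%N := prime_gt1 lp.
have hn : (`|h| < n)%N by rewrite (ltn_trans (ltnSn _))// ltn_expl.
have n1 : (1 < n)%N by rewrite -(exp1n k) ltn_exp2r.
have absE (z : int) : exists b : bool, z%:~R = (-1) ^+ b * `|z|%:R :> 'Z_n.
  by exists (z < 0)%R; rewrite {1}[z]intEsign rmorphM rmorphXn rmorphN1.
have lk0 : (l ^ k)%:R = 0 :> 'Z_n.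
  by apply: val_inj; rewrite /= val_Zp_nat// modnn.
exists 'Z_n, (intr : {rmorphism int -> 'Z_n}); split.
- exists (s%:~R^-1); rewrite /= mulrV//; have [b ->] := absE s.
  rewrite unitrMl ?unitrX ?unitrN1// unitZpE// coprimeXl//.
  rewrite prime_coprime//; apply: contraL sl => /dvdn_leq -/(_ _)/= H.
  by rewrite -leqNgt H// absz_gt0.
- rewrite /=; have [b ->] := absE h; apply: contra h0 => /eqP.
  move=> /(congr1 ( *%R ((-1) ^+ b))); rewrite signrMK mulr0 => /(congr1 val).
  rewrite /= val_Zp_nat// modn_small//.
  by move=> /eqP; rewrite absz_eq0.
- by exists k.
- have l0 : (0 < l)%N by lia.
  exists 'I_l, (fun a : 'Z_n => Ordinal (ltn_pmod a l0)); rewrite card_ord.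
  split=> // a b /(congr1 val)/= ab.
  have lnil : is_nilpotent (l%:R : 'Z_n) by exists k; rewrite -natrX.
  rewrite -(natr_Zp a) -(natr_Zp b) (divn_eq a l) (divn_eq b l) ab.
  by rewrite !natrD opprD addrACA subrr addr0 !natrM -mulrBl; exact: is_nilpotentMl.
Qed.

Section Adjunction.
Variables (K : fieldType) (A : comNzRingType) (i : {rmorphism A -> K}) (x : K).

Definition adjoin_pred : {pred K} :=
  [pred y | `[< exists p : {poly A}, (map_poly i p).[x] = y >]].

Fact adjoin_subring_closed : subring_closed adjoin_pred.
Proof.
split.
- by apply/asboolP; exists 1; rewrite rmorph1 hornerE.
- move=> _ _ /asboolP[p <-] /asboolP[q <-]; apply/asboolP; exists (p - q).
  by rewrite rmorphB !hornerE.
- move=> _ _ /asboolP[p <-] /asboolP[q <-]; apply/asboolP; exists (p * q).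
  by rewrite rmorphM !hornerE.
Qed.

HB.instance Definition _ :=
  GRing.isSubringClosed.Build K adjoin_pred adjoin_subring_closed.

Record adjoin := Adjoin { adjoin_val :> K ; adjoin_valP : adjoin_val \in adjoin_pred }.
HB.instance Definition _ := [isSub for adjoin_val].
HB.instance Definition _ := [Choice of adjoin by <:].
HB.instance Definition _ := [SubChoice_isSubComNzRing of adjoin by <:].

Fact adjoin_evalP (p : {poly A}) : (map_poly i p).[x] \in adjoin_pred.
Proof. by apply/asboolP; exists p. Qed.

Definition adjoin_eval p := Adjoin (adjoin_evalP p).

Fact adjoin_eval_zmod : zmod_morphism adjoin_eval.
Proof. by move=> p q; apply: val_inj; rewrite /= rmorphB !hornerE. Qed.
Fact adjoin_eval_monoid : monoid_morphism adjoin_eval.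
Proof.
by split=> [|p q]; apply: val_inj; rewrite /= ?rmorph1 ?rmorphM !hornerE.
Qed.
HB.instance Definition _ := GRing.isZmodMorphism.Build {poly A} adjoin adjoin_eval
  adjoin_eval_zmod.
HB.instance Definition _ := GRing.isMonoidMorphism.Build {poly A} adjoin adjoin_eval
  adjoin_eval_monoid.

Lemma specializable_adjoin :
  injective i -> specializable A -> specializable adjoin.
Proof.
move=> i_inj; apply: (@specializable_extension A adjoin adjoin_eval).
- move=> a b /(congr1 val)/= /eqP; rewrite mulf_eq0.
  by case/orP => /eqP ?; [left|right]; apply: val_inj.
- move=> b; have /asboolP[p pb] := valP b; exists p; exact: val_inj.
- move=> a /(congr1 val)/=; rewrite map_polyC hornerC /=.
  by rewrite -[RHS](rmorph0 i) => /i_inj.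
Qed.

End Adjunction.

(** The integers embed because [K] has characteristic 0; the elements of [xs] are then adjoined one
    at a time. *)
Theorem specializable_subring (K : numFieldType) (xs : seq K) :
  exists (B : comNzRingType) (i : {rmorphism B -> K}),
    [/\ injective i, specializable B & forall x, x \in xs -> exists b, i b = x].
Proof.
elim: xs => [|x xs [A [i [i_inj A_spec im]]]].
  exists int, (intr : {rmorphism int -> K}); split => //.
    by apply: intr_inj.
  exact: specializable_int.
exists (adjoin i x), (val : {rmorphism adjoin i x -> K}); split.
- exact: val_inj.
- exact: specializable_adjoin.
- move=> y; rewrite inE => /predU1P[->|/im[b <-]].
    by exists (adjoin_eval i x 'X); rewrite /= map_polyX hornerX.
  by exists (adjoin_eval i x b%:P); rewrite /= map_polyC hornerC.
Qed.

(** * Congruence subgroups *)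

Section NilCongruence.
Variable R : comNzRingType.
Implicit Types a b : R.

Definition nil_eq a b := is_nilpotent (a - b).

Lemma nil_eq_refl a : nil_eq a a.
Proof. by rewrite /nil_eq subrr; exact: is_nilpotent0. Qed.

Lemma nil_eqD a b c d : nil_eq a b -> nil_eq c d -> nil_eq (a + c) (b + d).
Proof. by move=> ab cd; rewrite /nil_eq opprD addrACA; exact: is_nilpotentD. Qed.

Lemma nil_eqM a b c d : nil_eq a b -> nil_eq c d -> nil_eq (a * c) (b * d).
Proof.
move=> ab cd; have -> : a * c = a * (c - d) + d * (a - b) + b * d by ring.
by rewrite /nil_eq addrK; apply: is_nilpotentD; exact: is_nilpotentMl.
Qed.

Lemma nil_eqMx m n p (A A' : 'M[R]_(m, n)) (B B' : 'M[R]_(n, p)) :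
  (forall i j, nil_eq (A i j) (A' i j)) -> (forall i j, nil_eq (B i j) (B' i j)) ->
  forall i j, nil_eq ((A *m B) i j) ((A' *m B') i j).
Proof.
move=> AA' BB' i j; rewrite !mxE.
by elim/big_ind2: _ => [|? ? ? ?|k _]; [exact: nil_eq_refl|exact: nil_eqD|exact: nil_eqM].
Qed.

Lemma nil_eq_det n (A B : 'M[R]_n) :
  (forall i j, nil_eq (A i j) (B i j)) -> nil_eq (\det A) (\det B).
Proof.
move=> AB; rewrite /determinant.
elim/big_ind2: _ => [|? ? ? ?|s _]; [exact: nil_eq_refl|exact: nil_eqD|].
apply: nil_eqM; first exact: nil_eq_refl.
by elim/big_ind2: _ => [|? ? ? ?|i _] //; [exact: nil_eq_refl|exact: nil_eqM].
Qed.

(** The determinant is 1 plus a nilpotent, hence a unit, and the adjugate supplies the inverse. *)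
Lemma nil_eq1_inv n (A : 'M[R]_n) :
  (forall i j, nil_eq (A i j) (1%:M i j)) -> exists B, A *m B = 1%:M /\ B *m A = 1%:M.
Proof.
move=> A1; have := nil_eq_det A1; rewrite det1 => /is_nilpotent_unit[u].
rewrite addrCA subrr addr0 => Au; exists (u *: \adj A).
by rewrite -scalemxAr -scalemxAl mul_mx_adj mul_adj_mx scale_scalar_mx mulrC Au.
Qed.

End NilCongruence.

(** An alias that carries a finite ring structure, so that its units form a finite group; the size
    is positive to make the ring nontrivial. *)
Definition finmx (R : finComNzRingType) (m : nat) : Type := 'M[R]_m.+1.
HB.instance Definition _ R m := GRing.NzRing.on (finmx R m).
HB.instance Definition _ R m := Finite.on (finmx R m).
HB.instance Definition _ R m := FinRing.isNzRing.Build (finmx R m).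

Section CongruenceGroup.
Local Open Scope group_scope.
Local Open Scope ring_scope.
Variables (R : finComNzRingType) (m l : nat).
Hypothesis l_prime : prime l.
Hypothesis l_nil : exists k, (l ^ k)%:R = 0 :> R.
Let M := finmx R m.

Definition nil_congr (A B : M) := `[< forall i j, nil_eq (A i j) (B i j) >].

Lemma nil_congrM (A B C D : M) :
  nil_congr A B -> nil_congr C D -> nil_congr (A * C) (B * D).
Proof. by move=> /asboolP AB /asboolP CD; apply/asboolP; exact: nil_eqMx. Qed.

Lemma nil_congr_refl (A : M) : nil_congr A A.
Proof. by apply/asboolP => i j; exact: nil_eq_refl. Qed.

Definition nil_mx : {set M} := finset (fun A => nil_congr A 0).

Lemma nil_mxP (A : M) : reflect (forall i j, is_nilpotent (A i j)) (A \in nil_mx).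
Proof.
rewrite inE; apply: (iffP (asboolP _)) => AP i j; have := AP i j;
  by rewrite /nil_eq mxE subr0.
Qed.

Lemma nil_mx_group : group_set nil_mx.
Proof.
apply/group_setP; split; first by apply/nil_mxP => i j; rewrite mxE; exact: is_nilpotent0.
move=> A B /nil_mxP A0 /nil_mxP B0; apply/nil_mxP => i j.
by rewrite mxE; exact: is_nilpotentD.
Qed.

(** A power of [l] kills the additive group, so by Cauchy's theorem no other prime divides its
    order. *)
Lemma card_nil_mx : l.-nat #|nil_mx|.
Proof.
have [k lk] := l_nil.
apply/(@pgroupP _ _ (Group nil_mx_group)) => q q_prime /(Cauchy q_prime)[A _ Aq].
have : (A ^+ (l ^ k))%g = 1%g.
  apply/matrixP => i j; rewrite FinRing.zmodXgE.
  by rewrite mxE mulmxnE -mulr_natr lk mulr0.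
move/eqP; rewrite -order_dvdn Aq Euclid_dvdX// => /andP[+ _].
by rewrite dvdn_prime2.
Qed.

Definition congr_subgroup : {set {unit M}} := finset (fun u => nil_congr (val u) 1).

Lemma congr_group_set : group_set congr_subgroup.
Proof.
apply/group_setP; split; first by rewrite inE nil_congr_refl.
by move=> u v; rewrite !inE => u1 v1; have := nil_congrM u1 v1; rewrite mulr1.
Qed.
Canonical congr_group := Group congr_group_set.

(** A matrix congruent to 1 is automatically invertible, so translation by 1 matches the congruence
    subgroup with [nil_mx]. *)
Lemma congr_pgroup : l.-group congr_group.
Proof.
suff cardE : #|congr_subgroup| = #|nil_mx| by rewrite /pgroup cardE card_nil_mx.
have subE (A B : M) i j : (A - B) i j = A i j - B i j.
  by rewrite mxE [X in _ + X]mxE.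
rewrite -(card_imset _ (inj_comp (addIr (- 1)) val_inj)).
apply: eq_card => A; apply/imsetP/nil_mxP => [[u + ->] i j|A0].
  by rewrite inE => /asboolP/(_ i j); rewrite /nil_eq /= subE.
have A1 : nil_congr (A + 1) 1.
  by apply/asboolP => i j; rewrite /nil_eq -subE addrK; have /nil_mxP := A0.
have /asboolP/nil_eq1_inv[B [AB BA]] := A1.
have uA : (A + 1 : M) \is a GRing.unit by apply/unitrP; exists B.
by exists (FinRing.unit M uA); rewrite ?inE//= addrK.
Qed.

(** A coset is determined by the classes of the entries of a representative. *)
Lemma index_congr C (I : {group {unit M}}) : nil_classes R C ->
  (#|I : I :&: congr_group| <= C ^ (m.+1 * m.+1))%N.
Proof.
move=> [T [k [TC kP]]].
pose F (X : {set {unit M}}) := [ffun ij => k (val (repr X) ij.1 ij.2)].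
apply: (@leq_trans #|{ffun 'I_m.+1 * 'I_m.+1 -> T}|); last first.
  by rewrite card_ffun card_prod card_ord leq_exp2r.
rewrite /indexg -(@card_in_imset _ _ F) ?max_card//.
move=> _ _ /rcosetsP[u uI ->] /rcosetsP[v vI ->] /ffunP FE.
set H := I :&: congr_group; have repr_in (w : {unit M}) : w \in I ->
    repr (H :* w) \in H :* w /\ repr (H :* w) \in I.
  move=> wI; have rw := mem_repr_rcoset [group of H] w; split => //.
  by case/rcosetP: rw => z; rewrite inE => /andP[zI _] ->; rewrite groupM.
have [ru rI] := repr_in u uI; have [rv rvI] := repr_in v vI.
rewrite -(rcoset_eqP ru) -(rcoset_eqP rv).
move: FE {ru rv}; rewrite /F; move: (repr _) (repr _) rI rvI => a b aI bI FE.
apply/rcoset_eqP; rewrite mem_rcoset inE groupM ?groupV//= inE.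
have ba : nil_congr (val b) (val a).
  by apply/asboolP => i j; apply: kP; have := FE (i, j); rewrite !ffunE.
have := nil_congrM ba (nil_congr_refl (val a^-1%g)).
by rewrite [X in nil_congr _ X -> _](mulrV (valP a)).
Qed.

End CongruenceGroup.

(** * Subgroups of controlled index *)

(** The finite index subgroup meant is the preimage of [H] under [rho]. Recording it inside the
    finite image [I] of [G] makes finite group theory applicable. *)
Definition prime_power_indices (G : groupType) (l : nat) :=
  exists C, forall i, exists (gT : finGroupType) (rho : G -> gT) (I H : {group gT}),
    [/\ {morph rho : x y / (x * y)%g}, forall y, y \in I <-> exists x, rho x = y,
        H \subset I, (l ^ i %| #|I : H|%g)%N & (#|I : H|%g <= C * l ^ i)%N].

Lemma morph_image_group (G : groupType) (gT : finGroupType) (rho : G -> gT) :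
  {morph rho : x y / (x * y)%g} ->
  exists I : {group gT}, forall y, y \in I <-> exists x, rho x = y.
Proof.
move=> rhoM; pose I := finset (fun y => `[< exists x, rho x = y >]).
have IP y : y \in I <-> exists x, rho x = y by rewrite inE; split=> /asboolP.
have rho1 : rho 1%g = 1%g.
  by apply: (mulgI (rho 1%g)); rewrite -rhoM !mulg1.
have gI : group_set I.
  apply/group_setP; split; first by apply/IP; exists 1%g.
  move=> _ _ /IP[x <-] /IP[y <-]; apply/IP; exists (x * y)%g; exact: rhoM.
by exists (Group gI).
Qed.

(** The bounds on the index of [Q] and on the order of [I] give [l ^ i <= #|Q|], and an [l]-group
    has subgroups of every order dividing its own, so [Q] has one of index [l ^ i]. *)
Lemma pgroup_index (gT : finGroupType) (l i C : nat) (I Q : {group gT}) :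
  prime l -> (l.-group Q)%g -> Q \subset I -> (#|I : Q|%g <= C)%N ->
  (C * l ^ i <= #|I|)%N ->
  exists H : {group gT},
    [/\ H \subset I, (l ^ i %| #|I : H|%g)%N & (#|I : H|%g <= C * l ^ i)%N].
Proof.
move=> l_prime lQ QI IQ CI.
have [e Qe] := p_natP lQ.
have l1 := prime_gt1 l_prime.
have ie : (i <= e)%N.
  rewrite -(leq_exp2l _ _ l1) -Qe; have := Lagrange QI; have := cardG_gt0 Q.
  have IQ0 := indexg_gt0 I Q; move: CI IQ => /leq_trans CI IQ Q0 E.
  have C0 : (0 < C)%N by apply: leq_trans IQ.
  rewrite -(leq_pmul2l C0); apply: CI; rewrite -E mulnC; exact: leq_mul.
have [|H [HQ _ cardH]] := @normal_pgroup l gT (e - i) Q Q lQ (normal_refl Q).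
  by rewrite Qe pfactorK// leq_subr.
have QH : #|Q : H|%g = (l ^ i)%N.
  by rewrite -divgS// Qe cardH -expnB ?leq_subr ?prime_gt0// subKn.
exists H; rewrite -(Lagrange_index QI HQ) QH; split.
- by rewrite (fintype.subset_trans HQ).
- exact: dvdn_mull.
- by rewrite leq_mul2r IQ orbT.
Qed.

Section FiniteQuotients.
Variables (G : groupType) (B : comNzRingType) (m : nat) (F : G -> 'M[B]_m.+1).
Hypothesis B_domain : forall a b : B, a != 0 -> b != 0 -> a * b != 0.
Hypothesis B_spec : specializable B.
Hypothesis F1 : F 1%g = 1%:M.
Hypothesis FM : forall x y, F (x * y)%g = F x *m F y.
Hypothesis F_inj : injective F.
Hypothesis G_infinite : infinite_set [set: G]%classic.

(** Each pair of distinct elements contributes a nonzero difference of matrix entries; [h] is the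
    product of these. *)
Lemma separating_element (s : seq G) : exists2 h : B, h != 0 &
  forall (R : comNzRingType) (phi : {rmorphism B -> R}), phi h != 0 ->
    {in s &, injective (fun g => map_mx phi (F g))}.
Proof.
have sep g g' : exists d : B, d != 0 /\ (g != g' ->
    forall (R : comNzRingType) (phi : {rmorphism B -> R}),
      map_mx phi (F g) = map_mx phi (F g') -> phi d = 0).
  have [->|gg'] := eqVneq g g'; first by exists 1; rewrite oner_eq0.
  have : ~ forall i j, F g i j = F g' i j.
    by move=> E; move/eqP: gg'; apply; apply: F_inj; apply/matrixP.
  move=> /existsNP[i /existsNP[j /eqP Fij]]; exists (F g i j - F g' i j).
  rewrite subr_eq0; split => // _ R phi /matrixP/(_ i j); rewrite !mxE rmorphB => ->.
  by rewrite subrr.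
pose d g g' := sval (cid (sep g g')).
have dP g g' := svalP (cid (sep g g')).
exists (\prod_(g <- s) \prod_(g' <- s) d g g').
  have prod_neq0 (E : G -> B) : (forall g, E g != 0) -> \prod_(g <- s) E g != 0.
    by move=> E0; elim/big_ind: _ => //; exact: oner_neq0.
  by apply: (prod_neq0) => ?; apply: (prod_neq0) => ?; exact: (dP _ _).1.
move=> R phi + g g' gs g's E; apply: contra_neqP => /eqP gg'.
rewrite rmorph_prod (perm_big _ (perm_to_rem gs)) big_cons rmorph_prod /=.
rewrite [X in X * _](perm_big _ (perm_to_rem g's)) big_cons.
by rewrite ((dP g g').2 gg' _ _ E) /= !mul0r.
Qed.

Lemma linear_prime_power_indices :
  exists L, forall l, prime l -> (L < l)%N -> prime_power_indices G l.
Proof.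
have [L LP] := B_spec (oner_neq0 B).
exists L => l l_prime /(LP l l_prime)[C CP]; exists (C ^ (m.+1 * m.+1))%N => i.
(* As many elements as [pgroup_index] requires in [I]; [phi] will keep their images distinct. *)
have [s _ ss] := infinite_set_fset (C ^ (m.+1 * m.+1) * l ^ i) G_infinite.
have [h h0 hP] := separating_element s.
have [R [phi [_ phih lk RC]]] := CP h h0.
have inj := hP _ _ phih.
pose M := finmx R m.
have FK x y : (x * y = 1)%g -> map_mx phi (F x) *m map_mx phi (F y) = 1%:M.
  by move=> xy; rewrite -map_mxM -FM xy F1 map_mx1.
have FU g : (map_mx phi (F g) : M) \is a GRing.unit.
  apply/unitrP; exists (map_mx phi (F g^-1%g)).
  by split; [exact: FK (mulVg g)|exact: FK (mulgV g)].
pose rho g : {unit M} := FinRing.unit M (FU g).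
have rhoM : {morph rho : x y / (x * y)%g}.
  by move=> x y; apply: val_inj; rewrite /= FM map_mxM.
have [I IP] := morph_image_group rhoM.
have sI : (C ^ (m.+1 * m.+1) * l ^ i <= #|I|)%N.
  apply: leq_trans ss _; pose t := map rho s.
  have ut : uniq t.
    rewrite map_inj_in_uniq ?fset_uniq// => x y xs ys /(congr1 val).
    exact: inj.
  rewrite -(size_map rho) -(card_uniqP ut); apply: subset_leq_card.
  by apply/fintype.subsetP => _ /mapP[x _ ->]; apply/IP; exists x.
have [H [HI Hd HC]] := pgroup_index l_prime
  (pgroupS (subsetIr I (congr_group R m)) (congr_pgroup m l_prime lk))
  (subsetIl _ _) (index_congr I RC) sI.
by exists {unit M}, rho, I, H.
Qed.

End FiniteQuotients.

Lemma linear_group_prime_power_indices (K : numFieldType) (m : nat)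
    (S : {pred GL K m}) (Gamma : subGroupType S) :
  infinite_set [set: Gamma]%classic -> finitely_generated Gamma ->
  exists L, forall l, prime l -> (L < l)%N -> prime_power_indices Gamma l.
Proof.
(* In size 0 the group is trivial, against infiniteness. *)
case: m S Gamma => [|m] S Gamma G_infinite [X /finite_seqP[s ->] X_gen].
  case: G_infinite; apply: (@sub_finite_set _ _ [set 1%g]%classic) => // x _ /=.
  by apply: val_inj; apply: val_inj; apply/matrixP => -[].
pose E (g : Gamma) : 'M[K]_m.+1 := GLmx (val g).
have EM x y : E (x * y)%g = E x *m E y by rewrite /E valM.
have E1 : E 1%g = 1%:M by rewrite /E val1.
have E_inj : injective E by move=> x y /val_inj/val_inj.
pose entries g := [seq E g ij.1 ij.2 | ij <- enum {: 'I_m.+1 * 'I_m.+1}].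
(* Entries of inverses are included so that the elements defined over [B] together with their
   inverse form a subgroup containing the generators. *)
pose xs := flatten [seq entries g ++ entries g^-1%g | g <- s].
have [B [i [i_inj B_spec xsP]]] := specializable_subring xs.
pose integral g := exists A : 'M[B]_m.+1, map_mx i A = E g.
have integral_gen g : g \in s -> integral g /\ integral g^-1%g.
  move=> gs; have entryP j k h : h = g \/ h = g^-1%g -> exists b, i b = E h j k.
    move=> hg; apply: xsP; apply/flattenP.
    exists (entries g ++ entries g^-1%g); first exact: map_f.
    by rewrite mem_cat; apply/orP; case: hg => ->; [left|right];
      apply/mapP; exists (j, k); rewrite ?mem_enum.
  have mxP h : h = g \/ h = g^-1%g -> integral h.
    move=> hg; exists (\matrix_(j, k) sval (cid (entryP j k h hg))).
    by apply/matrixP => j k; rewrite !mxE; exact: svalP (cid (entryP j k h hg)).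
  by split; apply: mxP; [left|right].
have integralM x y : integral x -> integral y -> integral (x * y)%g.
  by move=> [A AE] [A' AE']; exists (A *m A'); rewrite map_mxM EM AE AE'.
have integral_all g : integral g.
  suff [] : integral g /\ integral g^-1%g by [].
  have : smallest (@is_subgroup Gamma) [set` s]%classic g by rewrite X_gen.
  move=> /(_ [set h | integral h /\ integral h^-1%g]%classic); apply.
  split=> [|x]; last exact: integral_gen.
  have int1 : integral 1%g by exists 1%:M; rewrite map_mx1.
  split => [|x y [x1 x2] [y1 y2]|x [x1 x2]]; rewrite /= ?invg1 ?invgM ?invgK //.
    by split; exact: integralM.
pose F g := sval (cid (integral_all g)).
have FE g : map_mx i (F g) = E g := svalP (cid (integral_all g)).
have mi_inj : injective (map_mx i : 'M[B]_m.+1 -> 'M[K]_m.+1).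
  by move=> A A' /matrixP AA'; apply/matrixP => j k; have := AA' j k;
    rewrite !mxE => /i_inj.
apply: (@linear_prime_power_indices Gamma B m F) => //.
- have i0 b : b != 0 -> i b != 0.
    by apply: contra_neq; rewrite -[RHS](rmorph0 i); exact: i_inj.
  move=> a b /i0 a0 /i0 b0; apply/eqP => /(congr1 i)/eqP.
  by rewrite rmorphM rmorph0 mulf_eq0; apply/negP; rewrite negb_or a0.
- by apply: mi_inj; rewrite FE E1 map_mx1.
- by move=> x y; apply: mi_inj; rewrite map_mxM !FE.
- by move=> x y /(congr1 (map_mx i)); rewrite !FE => /E_inj.
Qed.

(** In the image of [G] in the product of the two finite groups, pull both subgroups back along the
    projections. Their indices are unchanged, and that of the intersection is divisible by the
    coprime numbers [p ^ i] and [q ^ j]. *)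
Lemma combine_prime_power_indices (G : groupType) p q :
  prime p -> prime q -> p != q ->
  prime_power_indices G p -> prime_power_indices G q ->
  exists C, forall i j, exists (gT : finGroupType) (rho : G -> gT) (I H K : {group gT}),
    [/\ {morph rho : x y / (x * y)%g}, forall y, y \in I <-> exists x, rho x = y,
        H \subset I /\ K \subset I,
        (#|I : H|%g <= C * p ^ i)%N /\ (#|I : K|%g <= C * q ^ j)%N
      & (p ^ i * q ^ j <= #|I : H :&: K|%g)%N].
Proof.
move=> p_prime q_prime pq [C1 G1] [C2 G2]; exists (maxn C1 C2) => i j.
have [gT1 [rho1 [I1 [H1 [rho1M I1P HI1 pH1 H1C]]]]] := G1 i.
have [gT2 [rho2 [I2 [H2 [rho2M I2P HI2 pH2 H2C]]]]] := G2 j.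
pose rho x := (rho1 x, rho2 x).
have rhoM : {morph rho : x y / (x * y)%g}.
  by move=> x y; rewrite /rho rho1M rho2M.
have [I IP] := morph_image_group rhoM.
have pullback (rT : finGroupType) (f : gT1 * gT2 -> rT) (J H : {group rT}) :
    {morph f : x y / (x * y)%g} -> (forall y, y \in J <-> exists x, f (rho x) = y) ->
    H \subset J ->
    exists K : {group gT1 * gT2}, K \subset I /\ #|I : K|%g = #|J : H|%g.
  move=> fM JP HJ; pose f' := @Morphism _ _ I f (in2W fM).
  have JI : J \subset (f' @* I)%g.
    apply/fintype.subsetP => y /JP[x <-]; rewrite /= morphimEdom.
    by apply: imset_f; apply/IP; exists x.
  exists (f' @*^-1 H)%G; split; first exact: subsetIl.
  rewrite -(index_morphpre H JI) /=; congr (#|_ : _|%g).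
  apply/eqP; rewrite finset.eqEsubset subsetIl andbT.
  apply/fintype.subsetP => _ /IP[x <-].
  by rewrite !inE; apply/andP; split; [apply/IP|apply/JP]; exists x.
have [H [HI HE]] := pullback _ fst I1 H1 (@fst_morphM gT1 gT2) I1P HI1.
have [K [KI KE]] := pullback _ snd I2 H2 (@snd_morphM gT1 gT2) I2P HI2.
exists (gT1 * gT2)%type, rho, I, H, K; split => //.
  rewrite HE KE; split; first by rewrite (leq_trans H1C)// leq_mul2r leq_maxl orbT.
  by rewrite (leq_trans H2C)// leq_mul2r leq_maxr orbT.
rewrite dvdn_leq ?indexg_gt0//.
rewrite Gauss_dvd; last by rewrite coprimeXl// coprimeXr// prime_coprime// dvdn_prime2.
rewrite -{1}(Lagrange_index HI (subsetIl H K)) dvdn_mulr ?HE//=.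
by rewrite -(Lagrange_index KI (subsetIr H K)) dvdn_mulr ?KE.
Qed.

(** * Measure on the profinite completion *)

Section FiniteQuotient.
Local Open Scope classical_set_scope.
Variables (R : realType) (G : groupType) (mu : probability (borel G) R).
Hypothesis mu_inv : forall (g : profinite G) (A : set (profinite G)),
  measurable (A : set (borel G)) -> mu [set (g * x)%g | x in A] = mu A.
Variables (gT : finGroupType) (rho : G -> gT) (I : {group gT}).
Hypothesis rhoM : {morph rho : x y / (x * y)%g}.
Hypothesis IP : forall y, y \in I <-> exists x, rho x = y.

Let rho1 : rho 1%g = 1%g.
Proof. by apply: (mulgI (rho 1%g)); rewrite -rhoM !mulg1. Qed.

Let rhoV x : rho x^-1%g = (rho x)^-1%g.
Proof. by apply: (mulgI (rho x)); rewrite -rhoM !mulgV rho1. Qed.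

Let rhoI x : rho x \in I. Proof. by apply/IP; exists x. Qed.

Definition rho_pre (A : {set gT}) : set G := [set x | rho x \in A].

Lemma rho_pre_subgroup (H : {group gT}) : is_subgroup (rho_pre H).
Proof.
split=> [|x y xH yH|x xH]; rewrite /rho_pre /=.
- by rewrite rho1 group1.
- by rewrite rhoM groupM.
- by rewrite rhoV groupV.
Qed.

Lemma rho_pre_lcosets (H : {group gT}) :
  Defs.lcosets (rho_pre H) `<=` [set` [fset rho_pre A | A in lcosets H I]%fset].
Proof.
move=> _ [g _ <-] /=; apply/imfsetP; exists (rho g *: H)%g.
  by apply/lcosetsP; exists (rho g) => //; exact: rhoI.
apply/seteqP; split=> [_ [x xH <-]|x]; rewrite /rho_pre /= mem_lcoset.
  by rewrite rhoM mulKg.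
by move=> xH; exists (g^-1 * x)%g; rewrite ?mulVKg//= rhoM rhoV.
Qed.

Lemma rho_pre_index (H : {group gT}) :
  finite_index (rho_pre H) /\ (subgroup_index (rho_pre H) <= #|I : H|%g)%N.
Proof.
have fin : finite_index (rho_pre H).
  exact: sub_finite_set (@rho_pre_lcosets H) (finite_fset _).
split => //; rewrite /subgroup_index -card_lcosets.
have card_le : (#|` [fset rho_pre A | A in lcosets H I]%fset| <= #|lcosets H I|)%N.
  apply: leq_trans (leq_imfset_card _ _ _) _; rewrite cardE.
  apply: uniq_leq_size; first exact: enum_finmem_uniq.
  by move=> A; rewrite enum_finmemE.
apply: leq_trans card_le; apply: fsubset_leq_card; apply/fsubsetP => A.
rewrite in_fset_set// => /set_mem.
exact: rho_pre_lcosets.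
Qed.

Lemma rho_ker_normal : is_normal (rho_pre 1%G).
Proof.
move=> x g; rewrite /rho_pre /= => /set1P x1; apply/set1P.
by rewrite /conjg !rhoM rhoV x1 mul1g mulVg.
Qed.

Definition rho_ker : fin_normal G :=
  FinNormal (rho_pre_subgroup 1%G) rho_ker_normal (rho_pre_index 1%G).1.

Let rho_ker1 : fin_normal_set rho_ker 1%g.
Proof. by have [] := rho_pre_subgroup 1%G. Qed.

(* The continuous extension of [rho] to the profinite completion. *)
Definition rho_hat (x : profinite G) : gT :=
  rho (sval (cid2 (componentP x rho_ker))).

Lemma rho_hatP (x : profinite G) u : x rho_ker u -> rho u = rho_hat x.
Proof.
rewrite /rho_hat; case: (cid2 _) => g _ /= <- [k /set1P k1 <-].
by rewrite rhoM k1 mulg1.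
Qed.

Lemma rho_hat_ex (x : profinite G) : exists2 u, x rho_ker u & rho u = rho_hat x.
Proof.
have [g _ xg] := componentP x rho_ker.
suff xg1 : x rho_ker g by exists g => //; exact: rho_hatP.
by rewrite -xg; exists 1%g; rewrite ?mulg1//; exact: rho_ker1.
Qed.

Lemma rho_hat_to_profinite g : rho_hat (to_profinite g) = rho g.
Proof.
rewrite -(@rho_hatP (to_profinite g) g)//.
by exists 1%g; rewrite ?mulg1//; exact: rho_ker1.
Qed.

Lemma rho_hatM x y : rho_hat (x * y)%g = (rho_hat x * rho_hat y)%g.
Proof.
have [u xu <-] := rho_hat_ex x; have [v yv <-] := rho_hat_ex y.
rewrite -rhoM -(@rho_hatP (x * y)%g (u * v)%g)//.
by exists u => //; exists v.
Qed.

(** The value depends only on the component at [rho_ker], which lies in a discrete space. *)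
Lemma rho_hat_open (A : set gT) : open (rho_hat @^-1` A).
Proof.
pose W : set (discrete_topology (set G)) := [set B | exists2 u, B u & A (rho u)].
exists (proj rho_ker @^-1` W).
  by apply: open_comp => [f _|]; [exact: proj_continuous|exact: discrete_open].
apply/seteqP; split=> [x [u xu] | x]; rewrite /= ?(rho_hatP xu)// => Ax.
by have [u xu uE] := rho_hat_ex x; exists u => //; rewrite uE.
Qed.

Lemma rho_hat_measurable (A : set gT) :
  measurable (rho_hat @^-1` A : set (borel G)).
Proof. by apply: sub_sigma_algebra; exact: rho_hat_open. Qed.

Lemma divisibility_le (H : {group gT}) x : H \subset I -> rho_hat x \notin H ->
  (divisibility R x <= (#|I : H|%g)%:R%:E)%E.
Proof.
move=> HI xH; have [fin le] := rho_pre_index H.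
apply: (@le_trans _ _ (subgroup_index (rho_pre H))%:R%:E); last first.
  by rewrite lee_fin ler_nat.
apply: ereal_inf_lbound; exists (rho_pre H) => //; split => //.
  exact: rho_pre_subgroup.
(* The points sent outside [H] form an open neighbourhood of [x] that misses the image of
   [rho_pre H]. *)
move=> /(_ (rho_hat @^-1` [set y | y \notin H])) [].
  by apply: open_nbhs_nbhs; split => //; exact: rho_hat_open.
by move=> _ [[g gH <-]]; rewrite /= rho_hat_to_profinite; apply/negP; rewrite negbK.
Qed.

Let c := mu (rho_hat @^-1` [set 1%g]).

(** Left translation by [to_profinite g] carries the fibre over 1 onto the fibre over [rho g]. *)
Lemma rho_hat_fiber y : y \in I -> mu (rho_hat @^-1` [set y]) = c.
Proof.
move=> /IP[g <-].
rewrite /c -[RHS](mu_inv (to_profinite g))//; last exact: rho_hat_measurable.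
congr (mu _); apply/seteqP; split=> [x /= xg|_ [x /= x1 <-]]; last first.
  by rewrite rho_hatM x1 mulg1 rho_hat_to_profinite.
exists ((to_profinite g)^-1 * x)%g; rewrite ?mulVKg//=.
apply: (mulgI (rho_hat (to_profinite g))).
by rewrite -rho_hatM mulVKg xg mulg1 rho_hat_to_profinite.
Qed.

Lemma rho_hat_measure (s : seq gT) : uniq s -> {subset s <= I} ->
  mu (rho_hat @^-1` [set` s]) = ((size s)%:R%:E * c)%E.
Proof.
elim: s => [_ _|y s IH /= /andP[ys us] sI].
  by rewrite mul0e [X in mu X](_ : _ = set0) ?measure0//; apply/seteqP; split.
have -> : rho_hat @^-1` [set` y :: s] =
    rho_hat @^-1` [set y] `|` rho_hat @^-1` [set` s].
  apply/seteqP; split=> x /=; rewrite inE.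
    by case/predU1P; [left|right].
  by case=> [->|->]; rewrite ?eqxx ?orbT.
have yI : y \in I by apply: sI; rewrite inE eqxx.
have sI' : {subset s <= I} by move=> z zs; apply: sI; rewrite inE zs orbT.
have ys0 : rho_hat @^-1` [set y] `&` rho_hat @^-1` [set` s] = set0.
  by apply/seteqP; split=> x //= [-> /(negP ys)].
have -> : mu (rho_hat @^-1` [set y] `|` rho_hat @^-1` [set` s]) =
    (mu (rho_hat @^-1` [set y]) + mu (rho_hat @^-1` [set` s]))%E.
  by apply: (@measureU _ _ (borel G) mu); rewrite ?ys0//; exact: rho_hat_measurable.
have -> : mu (rho_hat @^-1` [set y]) = c by exact: rho_hat_fiber.
have -> : mu (rho_hat @^-1` [set` s]) = ((size s)%:R%:E * c)%E by exact: IH.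
by rewrite -[in RHS]add1n natrD EFinD ge0_muleDl ?lee_fin// mul1e.
Qed.

(** All fibres over [I] have the same measure, so by Lagrange the left side is the measure of the
    preimage of [I]. *)
Lemma rho_hat_measure_subgroup (K : {group gT}) : K \subset I ->
  ((#|I : K|%g)%:R%:E * mu (rho_hat @^-1` [set` K]) <= 1)%E.
Proof.
move=> KI.
have muE (A : {set gT}) : A \subset I ->
    mu (rho_hat @^-1` [set` A]) = (#|A|%:R%:E * c)%E.
  move=> /fintype.subsetP AI; rewrite cardE -rho_hat_measure ?enum_uniq//.
    by congr (mu _); apply/seteqP; split=> x /=; rewrite mem_enum.
  by move=> y; rewrite mem_enum; exact: AI.
rewrite muE// muleA -EFinM -natrM mulnC Lagrange// -muE//.
by apply: probability_le1; exact: rho_hat_measurable.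
Qed.

End FiniteQuotient.

(** * Integrability from estimates on layers *)

Section LayerCake.

Local Open Scope classical_set_scope.
Local Open Scope ereal_scope.
Context d (T : measurableType d) (R : realType) (mu : {measure set T -> \bar R}).

(** The integral is a supremum over the simple functions below, and those below [f] are below
    [g]. *)
Lemma ge0_le_integralT (f g : T -> \bar R) :
  (forall x, 0 <= f x) -> (forall x, f x <= g x) ->
  \int[mu]_x f x <= \int[mu]_x g x.
Proof.
move=> f0 fg; rewrite !ge0_integralTE// => [|x]; last exact: le_trans (fg x).
apply: ereal_sup_le => _ [h hf <-]; exists h => // x.
exact: le_trans (fg x).
Qed.

(** [f] is dominated by the sum of the [c n] times the indicator of [V n]: if [V m.+1] is the first
    set missing [x], then [x] lies in [V m] and [f x <= c m]. Termwise integration gives a geometric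
    series of total [K]. *)
Lemma integral_layers_lty (f : T -> \bar R) (V : nat -> set T) (c : nat -> R) (K : R) :
  (forall x, 0 <= f x) -> (forall n, measurable (V n)) -> V 0%N = setT ->
  (forall n x, ~ V n.+1 x -> f x <= (c n)%:E) -> (forall n, n%:R <= c n)%R ->
  (0 <= K)%R -> (forall n, (c n)%:E * mu (V n) <= (K / (2 ^ n.+1)%:R)%:E) ->
  \int[mu]_x f x < +oo.
Proof.
move=> f0 mV V0 fV cn K0 cV.
have c0 n : (0 <= c n)%R by exact: le_trans (cn n).
pose g n (x : T) : \bar R := (c n)%:E * (\1_(V n) x)%:E.
have g0 n x : 0 <= g n x by rewrite mule_ge0// lee_fin.
have mg n : measurable_fun setT (g n : T -> \bar R).
  by apply: emeasurable_funM => //; apply/measurable_EFinP; exact: measurable_indic.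
have gV n x : V n x -> (c n)%:E <= \sum_(k <oo) g k x.
  move=> Vnx; apply: le_trans (nneseries_lim_ge n.+1 _) => // .
  rewrite big_nat_recr//= {2}/g indicE mem_set// mule1.
  by rewrite -[leLHS]add0e leeD2r// sume_ge0.
have fg x : f x <= \sum_(k <oo) g k x.
  have [n|allV] := pselect (exists n, ~ V n x); last first.
    (* At a point of every [V n] the dominating sum is infinite, since it exceeds each [c n] and
       [n <= c n]. *)
    rewrite [leRHS](_ : _ = +oo) ?leey//; apply/eqyP => A A0.
    have /ltW An := archi_boundP (ltW A0).
    apply: le_trans (gV (Num.bound A) x _); last first.
      by apply: contrapT => nV; apply: allV; exists (Num.bound A).
    by rewrite lee_fin (le_trans An).
  case: n => n nVn.
  have exn : exists n, `[< ~ V n x >] by exists n; apply/asboolP.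
  case: (ex_minnP exn) => -[|m] /asboolP nVm min; first by case: nVm; rewrite V0.
  apply: (le_trans (fV m x nVm)); apply: gV; apply: contrapT => nV.
  by have := min m; rewrite ltnn => /(_ (asboolT nV)).
apply: (le_lt_trans (ge0_le_integralT f0 fg)).
rewrite integral_nneseries//.
apply: (@le_lt_trans _ _ K%:E); last exact: ltry.
apply: le_trans (epsilon_trick0 xpredT K0).
apply: lee_nneseries => [n _ _|n _]; first exact: integral_ge0.
rewrite ge0_integralZl_EFin//; last by apply/measurable_EFinP; exact: measurable_indic.
by rewrite integral_indic// setIT.
Qed.

End LayerCake.

(** * Finiteness of the residual average *)

Lemma layer_exponent p q n : (1 < p)%N -> (1 < q)%N ->
  exists j, (q ^ j <= p ^ n < q ^ j.+1)%N.
Proof.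
move=> p1 q1; exists (trunc_log q (p ^ n)).
by apply: trunc_log_bounds; rewrite ?expn_gt0 ?(ltnW p1).
Qed.

(** One factor [p ^ n] of the hypothesis cancels and the other is at least [2 ^ n]; the factor
    [4 * p] absorbs the shifts of the exponents. *)
Lemma layer_bound (R : realType) (C p q n : nat) (v : \bar R) :
  (1 < p)%N -> (0 <= v)%E -> v \is a fin_num ->
  ((p ^ n * p ^ n)%:R%:E * v <= q%:R%:E)%E ->
  ((C * p ^ n.+1)%:R%:E * v <= ((4 * C * p * q)%:R / (2 ^ n.+2)%:R)%:E)%E.
Proof.
move=> p1; case: v => [r| |]// r0 _; rewrite -!EFinM !lee_fin in r0 * => rq.
rewrite ler_pdivlMr ?ltr0n ?expn_gt0//.
rewrite [leRHS](_ : _ = (4 * C * p)%:R * q%:R); last by rewrite -natrM.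
apply: le_trans (ler_wpM2l _ rq) => //.
rewrite mulrAC mulrA -!natrM ler_wpM2r// ler_nat.
have -> : (C * p ^ n.+1 * 2 ^ n.+2 = 4 * C * p * (p ^ n * 2 ^ n))%N.
  by rewrite !expnS; ring.
rewrite !leq_mul2l; apply/orP; right; apply/orP; right.
by case: n {rq} => // n; rewrite leq_exp2r.
Qed.

Lemma residual_average_lty (R : realType) (G : groupType) (mu : probability (borel G) R) p q :
  is_haar mu -> prime p -> prime q -> p != q ->
  prime_power_indices G p -> prime_power_indices G q ->
  (residual_average mu < +oo)%E.
Proof.
move=> [mu_inv _ _] p_prime q_prime pq Gp Gq.
have [C0 HC] := combine_prime_power_indices p_prime q_prime pq Gp Gq.
(* Positive, so that [n <= C * p ^ n]. *)
pose C := C0.+1.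
have p1 := prime_gt1 p_prime; have q1 := prime_gt1 q_prime.
have layer n : exists V : set (borel G), [/\ measurable V,
    ((p ^ n * p ^ n)%:R%:E * mu V <= q%:R%:E)%E &
    forall x, ~ V x -> (divisibility R x <= (C * p ^ n)%:R%:E)%E].
  have [j /andP[jn nj]] := layer_exponent n p1 q1.
  have [gT [rho [I [H [K [rhoM IP [HI KI] [HC' KC] HK]]]]]] := HC n j.
  have HKI : (H :&: K)%G \subset I by rewrite finset.subIset// HI.
  exists (rho_hat rhoM IP @^-1` [set` (H :&: K)%G])%classic; split.
  - exact: rho_hat_measurable.
  - have := rho_hat_measure_subgroup mu_inv rhoM IP HKI.
    set v := mu _ => muV.
    have v0 : (0 <= v)%E by exact: measure_ge0.
    (* The index is at least [p ^ n * q ^ j], and [p ^ n < q ^ j.+1]. *)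
    have pqI : (p ^ n * p ^ n <= q * #|I : (H :&: K)%G|%g)%N.
      rewrite (leq_trans _ (leq_mul (leqnn q) HK))// mulnCA leq_mul2l.
      by rewrite -expnS (ltnW nj) orbT.
    apply: (@le_trans _ _ ((q * #|I : (H :&: K)%G|%g)%:R%:E * v)%E).
      by rewrite lee_wpmul2r// lee_fin ler_nat.
    by rewrite natrM EFinM -muleA -[leRHS]mule1 lee_wpmul2l// lee_fin.
  - move=> x /negP; rewrite /= inE negb_and => /orP[xH|xK].
      apply: (le_trans (divisibility_le R HI xH)).
      by rewrite lee_fin ler_nat (leq_trans HC')// leq_mul2r leqnSn orbT.
    apply: (le_trans (divisibility_le R KI xK)).
    by rewrite lee_fin ler_nat (leq_trans KC)// leq_mul// leqnSn.
(* The shift puts the whole space first: outside [V n.+1], which is layer [n], the divisibility is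
   at most [C * p ^ n]. *)
pose V n : set (borel G) := if n is k.+1 then sval (cid (layer k)) else setT%classic.
apply: (@integral_layers_lty _ (borel G) R mu _ V (fun n => (C * p ^ n)%:R)
  (4 * C * p * q)%:R).
- by move=> x; apply: le_ereal_inf_tmp => _ [D _ <-]; rewrite lee_fin.
- by case=> [|n] //=; case: (svalP (cid (layer n))).
- by [].
- by move=> n x; case: (svalP (cid (layer n))) => _ _; apply.
- move=> n; rewrite ler_nat (leq_trans (ltnW (ltn_expl n p1)))//.
  by rewrite leq_pmull.
- by [].
case=> [|n].
  rewrite [X in (_ * X)%E](_ : _ = 1%E); last exact: probability_setT.
  rewrite mule1 lee_fin expn0 muln1 ler_pdivlMr ?ltr0n//.
  have pq0 : (0 < p * q)%N by rewrite muln_gt0 !prime_gt0.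
  rewrite -natrM ler_nat -(mulnA _ p); clear -pq0; move: C (p * q)%N pq0; nia.
case: (svalP (cid (layer n))) => mV muV _.
apply: layer_bound => //.
exact: fin_num_measure.
Qed.

Theorem theorem1p3 (R : realType) (m : nat) (S : {pred GL R[i] m})
    (Gamma : subGroupType S) (mu : probability (borel Gamma) R) :
  infinite_set [set: Gamma] -> finitely_generated Gamma ->
  is_haar mu -> (residual_average mu < +oo)%E.
Proof.
move=> G_infinite G_fg mu_haar.
have [L LP] := linear_group_prime_power_indices G_infinite G_fg.
have [p Lp p_prime] := prime_above L; have [q pq q_prime] := prime_above p.
apply: (residual_average_lty mu_haar p_prime q_prime); first by rewrite neq_ltn pq.
  exact: LP.
by apply: LP => //; exact: ltn_trans pq.
Qed.
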